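(* For $n\ge1$ let $G(n)$ be the number of ordinary partitions of $n$ into parts congruent to $\pm2,\pm3,\pm4,\pm5$ modulo $16$. Let $H(n)$ be the number of partitions of $n$ with $n$ copies of $n$ such that (i) every part $m_j$ has even subscript $j$, (ii) with parts in ascending lexicographic order, the weighted difference between each part and the preceding one is $\ge0$, and (iii) there is no pair of consecutive parts $a_i\le b_j$ (in this order) with $a$ and $b$ both odd and $((b_j-a_i))=0$. Then $G(n)=H(n)$.
   Context: $M=\{m_i: 1\le i\le m\}$; a partition with $n$ copies of $n$ is a finite multiset of elements of $M$ whose values (first entries) sum to the number partitioned. Lexicographic order: $m_i>n_j$ iff $m>n$, or $m=n$ and $i>j$. Weighted difference $((m_i-n_j))=m-n-i-j$. *)

(* Defs.v *)
From mathcomp Require Import all_boot all_order all_algebra.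
Set Implicit Arguments. Unset Strict Implicit. Unset Printing Implicit Defensive.

Fixpoint words (T : Type) (A : seq T) (k : nat) : seq (seq T) :=
  if k is k'.+1 then flatten [seq [seq a :: w | w <- words A k'] | a <- A]
  else [:: [::]].

(* All words of length <= n over A (a duplicate-free list when A is). *)
Definition words_upto (T : Type) (A : seq T) (n : nat) : seq (seq T) :=
  flatten [seq words A k | k <- iota 0 n.+1].

Definition G_part (p : nat) : bool := (p %% 16) \in [:: 2; 3; 4; 5; 11; 12; 13; 14].

(* An ordinary partition of n is represented canonically as the
   nondecreasing list of its (positive) parts. *)
Definition is_G_partition (n : nat) (s : seq nat) : bool :=
  [&& sorted leq s, all (fun p => 0 < p) s, sumn s == n & all G_part s].

(* every such list has length <= n and parts in 1..n *)
Definition G (n : nat) : nat := count (is_G_partition n) (words_upto (iota 1 n) n).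

(* A part m_i is the pair (m, i) with 1 <= i <= m. *)
Definition is_copy_part (p : nat * nat) : bool := (1 <= p.2 <= p.1).

Definition lex_le (p q : nat * nat) : bool :=
  (p.1 < q.1) || ((p.1 == q.1) && (p.2 <= q.2)).

Definition wdiff (p q : nat * nat) : int :=
  (p.1%:Z - q.1%:Z - p.2%:Z - q.2%:Z)%R.

Definition H_adj (a b : nat * nat) : bool :=
  (0 <= wdiff b a)%R && ~~ [&& odd a.1, odd b.1 & wdiff b a == 0%R].

(* A partition with n copies of n is represented canonically as the list of
   its parts in ascending lexicographic order. *)
Definition is_H_partition (n : nat) (s : seq (nat * nat)) : bool :=
  [&& sorted lex_le s, all is_copy_part s, sumn (map fst s) == n,
      all (fun p => ~~ odd p.2) s
    & sorted H_adj s].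

(* every such list has length <= n and parts (m, i) with m, i <= n *)
Definition H (n : nat) : nat :=
  count (is_H_partition n)
        (words_upto [seq (m, i) | m <- iota 1 n, i <- iota 1 n] n).

(* Main.v *)
Require Import Defs.
From mathcomp Require Import all_boot all_order all_algebra.
From mathcomp Require Import zify ring.

(** Both sides are compared through Slater's identity
      \sum_k q^(2k^2) / (q; q)_(2k) =
        \prod_(n = +-2, +-3, +-4, +-5 mod 16) 1 / (1 - q^n).

    Its left-hand side is the even part in [r], [q = r^2], of
    [\prod_i (1 + r^(2i+1))], by Euler's expansion.  Splitting that product into
    exponents 1 and 3 modulo 4, the triple product turns the even part into
    [\sum_l q^(4l^2-l) / (q^2; q^2)], and a second application of the triple
    product evaluates the theta series as [(-q^3, -q^5, q^8; q^8)].

    The term of index [k] counts the [H]-partitions with [k] parts: subtracting 2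
    from all parts, subtracting 2 from the first part and from its subscript and
    4 from the other parts, and removing a first part [2_2] or [3_2], together
    yield [(1 - q^(2k)) (1 - q^(4k-2)) H_k = q^(4k-2) (1 + q^(2k-1)) H_(k-1)].

    Everything is done with finite products in a ring where [q] is nilpotent, so
    that factors [1 - q^i] and [1 + q^i] can be cancelled and limits become
    equalities. *)

Set Implicit Arguments. Unset Strict Implicit. Unset Printing Implicit Defensive.
Import GRing.Theory Num.Theory.

(** * Gaussian binomials and the finite Jacobi triple product *)

Section QBinomial.
Local Open Scope ring_scope.
Variable R : comNzRingType.
Implicit Types (Q x y z : R).

Fixpoint qbin Q (n k : nat) : R :=
  match n, k with
  | _, 0 => 1
  | 0, _.+1 => 0
  | n'.+1, k'.+1 => qbin Q n' k' + Q ^+ k * qbin Q n' k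
  end.

Definition qpoch Q (n : nat) : R := \prod_(i < n) (1 - Q ^+ i.+1).

Lemma qbinS Q n k :
  qbin Q n.+1 k.+1 = qbin Q n k + Q ^+ k.+1 * qbin Q n k.+1.
Proof. by []. Qed.

Lemma qbin0 Q n : qbin Q n 0 = 1.
Proof. by case: n. Qed.

Lemma qbin_small Q n k : (n < k)%N -> qbin Q n k = 0.
Proof.
elim: n k => [|n IHn] [|k] //= lt_nk.
by rewrite !IHn ?mulr0 ?addr0 //; lia.
Qed.

Lemma qpochS Q n : qpoch Q n.+1 = qpoch Q n * (1 - Q ^+ n.+1).
Proof. exact: big_ord_recr. Qed.

(** Multiplied out because no division is available in [R]; later limits of Gaussian binomials all
    start from this form. *)
Lemma qbin_qpoch Q i j :
  qbin Q (i + j) i * (qpoch Q i * qpoch Q j) = qpoch Q (i + j).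
Proof.
move: {2}(i + j)%N (erefl (i + j)%N) => n; elim: n i j => [|n IHn] [|i] [|j] //.
- by move=> _; rewrite qbin0 /qpoch !big_ord0 !mul1r.
- by move=> _; rewrite add0n qbin0 /qpoch big_ord0 !mul1r.
- rewrite addSn addn0 => /succn_inj def_n.
  rewrite qbinS [qbin Q i i.+1]qbin_small ?mulr0 ?addr0 //.
  rewrite !qpochS -[in RHS](addn0 i) -IHn ?addn0 //; ring.
rewrite addSn => /succn_inj def_n.
have E1 := IHn i j.+1 def_n.
have E2 : qbin Q (i + j.+1) i.+1 * (qpoch Q i.+1 * qpoch Q j) =
          qpoch Q (i + j.+1) by rewrite -addSnnS IHn // addSnnS.
rewrite qbinS mulrDl [qpoch Q i.+1 in X in X + _ = _]qpochS.
rewrite [qpoch Q j.+1 in X in _ + X = _]qpochS [RHS]qpochS.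
have -> : Q ^+ (i + j.+1).+1 = Q ^+ i.+1 * Q ^+ j.+1.
  by rewrite -exprD; congr (_ ^+ _); lia.
(* Both terms of the Pascal rule become multiples of the same [qpoch], by 1 - Q^(i+j+2) = (1 -
   Q^(i+1)) + Q^(i+1) (1 - Q^(j+1)). *)
transitivity ((1 - Q ^+ i.+1) * qpoch Q (i + j.+1)
   + Q ^+ i.+1 * (1 - Q ^+ j.+1) * qpoch Q (i + j.+1)); last by ring.
rewrite -{1}E1 -E2; ring.
Qed.

Lemma big_ord_shift2 (F G : nat -> R) n :
  \sum_(k < n.+1) F k + \sum_(k < n.+1) G k =
  F 0%N + \sum_(k < n) (F k.+1 + G k) + G n.
Proof. by rewrite big_ord_recl [X in _ + X]big_ord_recr big_split /= !addrA. Qed.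

(** Induction peels off the factor [1 + x] and replaces [x] by [x * Q] in the rest; comparing
    coefficients of [x ^+ k] gives the Pascal rule. *)
Lemma qbinomial_theorem Q x n :
  \prod_(i < n) (1 + x * Q ^+ i) =
  \sum_(k < n.+1) qbin Q n k * (Q ^+ 'C(k, 2) * x ^+ k).
Proof.
elim: n x => [|n IHn] x.
  by rewrite big_ord0 big_ord_recl big_ord0 /= !mulr1 addr0.
have -> : \prod_(i < n.+1) (1 + x * Q ^+ i) =
          (1 + x) * \prod_(i < n) (1 + (x * Q) * Q ^+ i).
  rewrite big_ord_recl mulr1; congr (_ * _); apply: eq_bigr => i _.
  by rewrite lift0 exprS mulrA.
rewrite IHn mulrDl mul1r mulr_sumr
  (big_ord_shift2 (fun k => qbin Q n k * (Q ^+ 'C(k, 2) * (x * Q) ^+ k))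
                  (fun k => x * (qbin Q n k * (Q ^+ 'C(k, 2) * (x * Q) ^+ k)))).
rewrite [RHS]big_ord_recl big_ord_recr /= addrA !qbin0 !expr0; congr (_ + _ + _).
  apply: eq_bigr => k _; rewrite /=.
  by rewrite /bump !leq0n !add1n !add0n !exprMn binS bin1 !exprD !exprS; ring.
rewrite /bump !leq0n !add1n !add0n (@qbin_small _ n n.+1) // mulr0 addr0.
by rewrite !exprMn binS bin1 !exprD !exprS; ring.
Qed.

(* One of the two truncated subtractions always vanishes, so this is the
   bilateral exponent of the Jacobi triple product: [k - N = l] contributes
   [x ^ l Q ^ C(l, 2)] and [N - k = l] contributes [y ^ l Q ^ C(l, 2)]. *)
Definition jtp_term Q x y (N k : nat) : R :=
  Q ^+ 'C(k - N, 2) * x ^+ (k - N) * (Q ^+ 'C(N - k, 2) * y ^+ (N - k)).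

(** Multiplying by the new factor [y * Q ^+ N] moves the centre of the bilateral sum from [N] to
    [N.+1]. To the right of the centre a power of [x] is lost and one of [y] gained, which is where
    [x * y = Q] enters. *)
Lemma jtp_termS Q x y N k : x * y = Q ->
  Q ^+ k * jtp_term Q x y N.+1 k = y * Q ^+ N * jtp_term Q x y N k.
Proof.
move=> xyQ; rewrite /jtp_term; case: (leqP k N) => [le_kN | lt_Nk].
  have -> : (k - N.+1 = 0)%N by lia.
  have -> : (k - N = 0)%N by lia.
  rewrite (subSn le_kN) binS bin1 exprS.
  have -> : Q ^+ N = Q ^+ k * Q ^+ (N - k) by rewrite -exprD subnKC.
  rewrite !exprD; ring.
have -> : (N.+1 - k = 0)%N by lia.
have -> : (N - k = 0)%N by lia.
have -> : (k - N = (k - N.+1).+1)%N by lia.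
have -> : Q ^+ k = Q ^+ N * Q ^+ (k - N.+1) * (x * y).
  by rewrite xyQ -exprD -exprSr; congr (_ ^+ _); lia.
rewrite binS bin1 !exprD exprS; ring.
Qed.

(** Induction on [N] from the q-binomial theorem: [jtp_termS] supplies the power of [Q] in the
    Pascal rule. *)
Lemma finite_triple_product Q x y M N : x * y = Q ->
  \prod_(i < M) (1 + x * Q ^+ i) * \prod_(i < N) (1 + y * Q ^+ i) =
  \sum_(k < (M + N).+1) qbin Q (M + N) k * jtp_term Q x y N k.
Proof.
move=> xyQ; elim: N => [|N IHN].
  rewrite addn0 big_ord0 mulr1 qbinomial_theorem; apply: eq_bigr => k _.
  by rewrite /jtp_term !sub0n subn0 !mulr1.
rewrite big_ord_recr /= mulrA IHN mulrDr mulr1 mulr_suml addnS.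
rewrite addrC (big_ord_shift2
  (fun k => qbin Q (M + N) k * jtp_term Q x y N k * (y * Q ^+ N))
  (fun k => qbin Q (M + N) k * jtp_term Q x y N k)).
rewrite [RHS]big_ord_recl big_ord_recr /= addrA !qbin0 !mul1r.
have E k : jtp_term Q x y N k * (y * Q ^+ N) = Q ^+ k * jtp_term Q x y N.+1 k.
  by rewrite jtp_termS // mulrC.
have E' k : jtp_term Q x y N.+1 k.+1 = jtp_term Q x y N k.
  by rewrite /jtp_term !subSS.
congr (_ + _ + _); first by rewrite E expr0 mul1r.
  apply: eq_bigr => k _; rewrite /= /bump !leq0n !add1n !add0n.
  by rewrite -[X in X + _]mulrA E E'; ring.
by rewrite /bump !leq0n !add1n !add0n (@qbin_small _ _ (M + N).+1) // mulr0 addr0 E'.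
Qed.

End QBinomial.

(** * Cancellation and exact limits when [Q] is nilpotent *)

Section Nilpotent.
Local Open Scope ring_scope.
Variable R : comNzRingType.
Implicit Types (Q q r x y z : R).

(** Iterating x = x Q y gives x = x (Q y)^T = 0. *)
Lemma nilpotent_cancel Q T x y : Q ^+ T = 0 -> x * (1 - Q * y) = 0 -> x = 0.
Proof.
move=> QT0 /eqP; rewrite mulrBr mulr1 subr_eq0 => /eqP x_fix.
suff /(_ T) -> : forall k, x = x * (Q ^+ k * y ^+ k) by rewrite QT0 mul0r mulr0.
elim=> [|k IHk]; first by rewrite !mulr1.
by rewrite {1}x_fix {1}IHk !exprS; ring.
Qed.

Lemma one_sub_expr_inj Q T k x y : Q ^+ T = 0 ->
  x * (1 - Q ^+ k.+1) = y * (1 - Q ^+ k.+1) -> x = y.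
Proof.
move=> QT0 /eqP; rewrite -subr_eq0 -mulrBl exprS => /eqP xy0.
by apply/eqP; rewrite -subr_eq0 (nilpotent_cancel QT0 xy0).
Qed.

Lemma one_add_expr_inj Q T k x y : Q ^+ T = 0 ->
  x * (1 + Q ^+ k.+1) = y * (1 + Q ^+ k.+1) -> x = y.
Proof.
move=> QT0 /eqP; rewrite -subr_eq0 -mulrBl exprS -[Q * _]opprK -mulrN => /eqP xy0.
by apply/eqP; rewrite -subr_eq0 (nilpotent_cancel QT0 xy0).
Qed.

Lemma qpoch_inj Q T k x y : Q ^+ T = 0 ->
  x * qpoch Q k = y * qpoch Q k -> x = y.
Proof.
move=> QT0; elim: k => [|k IHk]; first by rewrite /qpoch big_ord0 !mulr1.
by rewrite qpochS !mulrA => /(one_sub_expr_inj QT0)/IHk.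
Qed.

(** The factors beyond index [c] act as 1 on [z]. A multiplier such as [z] replaces convergence in
    all the limits below. *)
Lemma qpoch_trunc Q z c n : z * Q ^+ c.+1 = 0 -> (c <= n)%N ->
  z * qpoch Q n = z * qpoch Q c.
Proof.
move=> zQ0; elim: n => [|n IHn]; first by rewrite leqn0 => /eqP->.
rewrite leq_eqVlt => /orP[/eqP->//|le_cn].
rewrite qpochS mulrA IHn // mulrBr mulr1 -(subnKC le_cn) exprD.
by rewrite [z * _ * _]mulrCA !mulrA [_ * z]mulrC zQ0 !mul0r subr0.
Qed.

(** Exact version of the limit 1 / (Q; Q)_i of the Gaussian binomial as [j] grows. *)
Lemma qbin_limit Q T z i j : Q ^+ T = 0 -> z * Q ^+ j.+1 = 0 ->
  z * (qbin Q (i + j) i * qpoch Q i) = z.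
Proof.
move=> QT0 zQ0; apply: (qpoch_inj (k := j) QT0).
by rewrite -!mulrA qbin_qpoch (qpoch_trunc zQ0) // leq_addl.
Qed.

(** Here both [i] and [j] grow, so the limit is 1 / (Q; Q)_oo; on [z] the finite product [qpoch Q l]
    stands for the infinite one. *)
Lemma central_qbin_limit Q T z i j l : Q ^+ T = 0 ->
    z * Q ^+ i.+1 = 0 -> z * Q ^+ j.+1 = 0 -> z * Q ^+ l.+1 = 0 ->
  z * (qbin Q (i + j) i * qpoch Q l) = z.
Proof.
move=> QT0 zQi zQj zQl; rewrite -[RHS](qbin_limit i QT0 zQj).
have [/(qpoch_trunc zQi) E|/ltnW/(qpoch_trunc zQl) E] := leqP i l.
  by rewrite mulrCA E mulrCA.
by rewrite mulrCA -E mulrCA.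
Qed.

(** * Even parts in [r] and the theta series *)

Lemma sum_even_odd (F : nat -> R) m :
  \sum_(k < (2 * m).+1) F k =
  \sum_(k < m.+1) F (2 * k)%N + \sum_(k < m) F (2 * k).+1.
Proof.
elim: m => [|m IHm]; first by rewrite muln0 !big_ord_recr !big_ord0 /= addr0.
rewrite mulnS !addSn add0n 2!big_ord_recr IHm /=.
rewrite [X in _ = X + _]big_ord_recr [X in _ = _ + X]big_ord_recr /= mulnS.
by rewrite !addSn add0n; ring.
Qed.

Lemma prod_even_odd (F : nat -> R) m :
  \prod_(k < 2 * m) F k = \prod_(k < m) (F (2 * k)%N * F (2 * k).+1).
Proof.
elim: m => [|m IHm]; first by rewrite muln0 !big_ord0.
by rewrite mulnS !addSn add0n !big_ord_recr IHm /= mulrA.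
Qed.

(** With l = k - M as an integer, this is q^(4 l^2 - l). *)
Definition theta_term q M k := jtp_term (q ^+ 8) (q ^+ 3) (q ^+ 5) M k.

Lemma theta_termE q M k : theta_term q M k =
  q ^+ (8 * 'C(k - M, 2) + 3 * (k - M) + (8 * 'C(M - k, 2) + 5 * (M - k))).
Proof. by rewrite /theta_term /jtp_term -!exprM !exprD. Qed.

Lemma muln_bin2 l : ('C(l, 2) * 2 = l * l.-1)%N.
Proof. by rewrite muln2 bin2 halfK oddM; case: l => //= l; rewrite andNb subn0. Qed.

Lemma jtp_term_sqr r M k :
  jtp_term (r ^+ 4) r (r ^+ 3) (2 * M) (2 * k) = theta_term (r ^+ 2) M k.
Proof.
rewrite theta_termE /jtp_term -!mulnBr -!exprM -!exprD; congr (_ ^+ _).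
have := muln_bin2 (2 * (k - M)); have := muln_bin2 (2 * (M - k)).
have := muln_bin2 (k - M); have := muln_bin2 (M - k).
by case: (k - M)%N => [|a]; case: (M - k)%N => [|b]; rewrite ?muln0 /=; nia.
Qed.

Lemma jtp_term_even r M k :
  jtp_term (r ^+ 4) (- r) ((- r) ^+ 3) (2 * M) (2 * k) =
  jtp_term (r ^+ 4) r (r ^+ 3) (2 * M) (2 * k).
Proof.
rewrite (_ : r ^+ 4 = (- r) ^+ 4) ?jtp_term_sqr; last by ring.
by rewrite [in RHS](_ : (- r) ^+ 4 = r ^+ 4) ?jtp_term_sqr ?sqrrN //; ring.
Qed.

Lemma jtp_term_odd r M k :
  jtp_term (r ^+ 4) (- r) ((- r) ^+ 3) (2 * M) (2 * k).+1 =
  - jtp_term (r ^+ 4) r (r ^+ 3) (2 * M) (2 * k).+1.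
Proof.
rewrite /jtp_term -![(_ ^+ 3) ^+ _]exprM.
rewrite -[- r]mulN1r !exprMn; set a := (_.+1 - _)%N; set b := (_ - _.+1)%N.
(* One of [a], [b] is 0 by truncation and the other is the odd distance between 2k+1 and 2M, so
   exactly one is odd. *)
have -> : (-1) ^+ (3 * b) = - (-1) ^+ a :> R.
  rewrite -signr_odd -[in RHS]signr_odd.
  have -> : odd (3 * b) = ~~ odd a by rewrite /a /b; lia.
  by case: (odd a); rewrite ?opprK.
by rewrite -(signr_odd _ a); case: (odd a); rewrite ?expr0 ?expr1; ring.
Qed.

(* Expand [\prod_(i < 4 * M) (1 + r ^+ (2 * i + 1))] both by the q-binomial
   theorem and, splitting the factors modulo 4, by the triple product; the
   terms even in [r] must agree. *)
Lemma even_part_identity r M : (forall x y : R, x + x = y + y -> x = y) ->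
  let q := r ^+ 2 in
  \sum_(k < (2 * M).+1) q ^+ (2 * k ^ 2) * qbin q (4 * M) (2 * k) =
  \sum_(k < (2 * M).+1) theta_term q M k * qbin (q ^+ 2) (4 * M) (2 * k).
Proof.
move=> two_inj q.
pose f s k := qbin q (4 * M) k * (q ^+ 'C(k, 2) * s ^+ k).
pose g s k :=
  qbin (q ^+ 2) (4 * M) k * jtp_term (q ^+ 2) s (s ^+ 3) (2 * M) k.
pose F s := \sum_(k < (4 * M).+1) f s k.
pose G s := \sum_(k < (4 * M).+1) g s k.
have def_4M : (4 * M = 2 * (2 * M))%N by lia.
(* Applied to [s = r] and [s = - r]. The factors are 1 + s^(2i+1): even [i] gives the triple product
   with x = s, odd [i] the one with y = s^3, both in base s^4. *)
have FG s : s ^+ 2 = q -> F s = G s.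
  move=> s2; rewrite /F /f -qbinomial_theorem.
  rewrite def_4M (prod_even_odd (fun i => 1 + s * q ^+ i)).
  rewrite /G /g (_ : 4 * M = 2 * M + 2 * M)%N; last by lia.
  rewrite -finite_triple_product -?s2; last by ring.
  rewrite -big_split; apply: eq_bigr => i _ /=; congr ((1 + _) * (1 + _)).
    by rewrite -!exprM; congr (_ * _ ^+ _); lia.
  by rewrite -!exprM -exprS -exprD; congr (_ ^+ _); lia.
have r4 : q ^+ 2 = r ^+ 4 by rewrite /q -exprM.
have sgn k : (- r) ^+ k = (-1) ^+ odd k * r ^+ k.
  by rewrite signr_odd -exprNn.
pose Feven := \sum_(k < (2 * M).+1) q ^+ (2 * k ^ 2) * qbin q (4 * M) (2 * k).
pose Geven := \sum_(k < (2 * M).+1)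
  theta_term q M k * qbin (q ^+ 2) (4 * M) (2 * k).
pose Fodd := \sum_(k < 2 * M) qbin q (4 * M) (2 * k).+1 *
  (q ^+ 'C((2 * k).+1, 2) * r ^+ (2 * k).+1).
pose Godd := \sum_(k < 2 * M) qbin (q ^+ 2) (4 * M) (2 * k).+1 *
  jtp_term (q ^+ 2) r (r ^+ 3) (2 * M) (2 * k).+1.
have split_sum (h : nat -> R) :
    \sum_(k < (4 * M).+1) h k =
    \sum_(k < (2 * M).+1) h (2 * k)%N + \sum_(k < 2 * M) h (2 * k).+1.
  by rewrite -sum_even_odd -def_4M.
have even_exp k : q ^+ 'C(2 * k, 2) * r ^+ (2 * k) = q ^+ (2 * k ^ 2).
  rewrite /q -!exprM -exprD; congr (_ ^+ _).
  by have := muln_bin2 (2 * k); case: k => //= k; nia.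
have Fr : F r = Feven + Fodd.
  rewrite /F (split_sum (f r)) /f; congr (_ + _); apply: eq_bigr => k _.
  by rewrite even_exp mulrC.
have FNr : F (- r) = Feven - Fodd.
  rewrite /F (split_sum (f (- r))) /f -sumrN; congr (_ + _); apply: eq_bigr => k _; rewrite sgn.
    by rewrite (_ : odd _ = false) ?mul1r ?even_exp 1?mulrC //; lia.
  by rewrite (_ : odd _ = true) ?mulN1r ?mulrN //; lia.
have Gr : G r = Geven + Godd.
  rewrite /G (split_sum (g r)) /g; congr (_ + _); apply: eq_bigr => k _.
  by rewrite r4 jtp_term_sqr mulrC.
have GNr : G (- r) = Geven - Godd.
  rewrite /G (split_sum (g (- r))) /g -sumrN; congr (_ + _); apply: eq_bigr => k _; rewrite r4.
    by rewrite jtp_term_even jtp_term_sqr mulrC.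
  by rewrite jtp_term_odd mulrN.
apply: (two_inj Feven Geven); transitivity (F r + F (- r)); first by rewrite Fr FNr; ring.
by rewrite !FG ?sqrrN // Gr GNr; ring.
Qed.

(* Both sums are the same theta series, multiplied in the limit by the inverses
   of [qpoch (q ^+ 2)] and [qpoch (q ^+ 8)]. *)
Lemma theta_limit q T M : q ^+ T = 0 -> (T <= M)%N ->
  (\sum_(k < (2 * M).+1) theta_term q M k * qbin (q ^+ 2) (4 * M) (2 * k)) *
    qpoch (q ^+ 2) (4 * M) =
  \prod_(i < M) ((1 + q ^+ (8 * i + 3)) * (1 + q ^+ (8 * i + 5))) *
    qpoch (q ^+ 8) M.
Proof.
move=> qT0 le_TM.
have q0 m : (T <= m)%N -> q ^+ m = 0.
  by move=> /subnKC <-; rewrite exprD qT0 mul0r.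
have qX0 a : (0 < a)%N -> (q ^+ a) ^+ T = 0.
  by move=> a_gt0; rewrite -exprM q0 // leq_pmull.
rewrite [in RHS](_ : \prod_(i < M) _ =
  \sum_(k < (2 * M).+1) theta_term q M k * qbin (q ^+ 8) (2 * M) k); last first.
  transitivity (\prod_(i < M) (1 + q ^+ 3 * (q ^+ 8) ^+ i) *
                \prod_(i < M) (1 + q ^+ 5 * (q ^+ 8) ^+ i)).
    rewrite -big_split; apply: eq_bigr => i _ /=.
    by rewrite -!exprM -!exprD ![(_ + 8 * i)%N]addnC.
  rewrite finite_triple_product -?exprD // addnn -mul2n.
  by apply: eq_bigr => k _; rewrite mulrC.
rewrite !mulr_suml; apply: eq_bigr => k _; rewrite -[LHS]mulrA -[RHS]mulrA.
case: k => k /= le_k.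
rewrite [in qbin _ (4 * M)](_ : 4 * M = 2 * k + (4 * M - 2 * k))%N; last by lia.
rewrite [in qbin _ (2 * M)](_ : 2 * M = k + (2 * M - k))%N; last by lia.
(* Near the ends of the range the binomial is far from its limit, but the theta exponent is at least
   3 |k - M|, so the total exponent still reaches [T]. *)
rewrite (central_qbin_limit (T := T)) ?qX0 //;
  try by rewrite theta_termE -exprM -exprD q0 //; lia.
by rewrite (central_qbin_limit (T := T)) ?qX0 //;
  rewrite theta_termE -exprM -exprD q0 //; lia.
Qed.

(** * The product side, by residues modulo 16 *)

Lemma prod_G_parts q K :
  \prod_(p <- iota 0 (16 * K) | G_part p) (1 - q ^+ p) =
  \prod_(i < K) \prod_(c <- [:: 2; 3; 4; 5; 11; 12; 13; 14]%N)
    (1 - q ^+ (16 * i + c)).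
Proof.
elim: K => [|K IHK]; first by rewrite big_ord0 big_nil.
rewrite mulnS addnC iotaD big_cat IHK big_ord_recr; congr (_ * _).
rewrite add0n -{1}[(16 * K)%N]addn0 iotaDl big_map /=.
rewrite (eq_bigl G_part) => [|c]; last by rewrite /G_part mulnC modnMDl.
by rewrite -big_filter.
Qed.

(** In terms of residue products modulo 16, the factors 1 + q^(8i+3) turn A(3) A(11) into A(6), and
    the factors 1 + q^(8i+5) turn A(5) A(13) into A(10). What remains is A(2) A(4) ... A(16). *)
Lemma prod_Slater39 q T : q ^+ T = 0 ->
  \prod_(i < 2 * T) ((1 + q ^+ (8 * i + 3)) * (1 + q ^+ (8 * i + 5))) *
    qpoch (q ^+ 8) (2 * T) *
    \prod_(p <- iota 0 (16 * T) | G_part p) (1 - q ^+ p) =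
  qpoch (q ^+ 2) (8 * T).
Proof.
move=> qT0.
pose A c := \prod_(i < T) (1 - q ^+ (16 * i + c)).
pose B c := \prod_(i < 2 * T) (1 + q ^+ (8 * i + c)).
(* Doubling the number of factors changes nothing, since the new exponents are at least [T]. *)
have trunc c : \prod_(i < 2 * T) (1 - q ^+ (16 * i + c.+1)) = A c.+1.
  rewrite mul2n -addnn big_split_ord /= [X in _ * X]big1 ?mulr1 // => i _.
  rewrite (_ : 16 * (T + i) + c.+1 = T + (15 * T + 16 * i + c.+1))%N; last by lia.
  by rewrite exprD qT0 mul0r subr0.
have AA c : A c * A (8 + c)%N = \prod_(i < 2 * T) (1 - q ^+ (8 * i + c)).
  rewrite (prod_even_odd (fun i => 1 - q ^+ (8 * i + c))) -big_split.
  by apply: eq_bigr => i _ /=; congr ((1 - q ^+ _) * (1 - q ^+ _)); lia.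
have BAA c : B c.+1 * (A c.+1 * A (8 + c.+1)%N) = A (2 * c.+1)%N.
  rewrite AA -big_split mulnS -trunc; apply: eq_bigr => i _ /=.
  rewrite (_ : 16 * i + (2 * c).+2 = (8 * i + c.+1) * 2)%N; last by lia.
  by rewrite exprM; ring.
have E8 : qpoch (q ^+ 8) (2 * T) = A 8 * A 16.
  rewrite (AA 8); apply: eq_bigr => i _; rewrite -exprM.
  by congr (1 - q ^+ _); lia.
have -> : qpoch (q ^+ 2) (8 * T) =
    \prod_(i < T) \prod_(c <- iota 0 8) (1 - q ^+ (16 * i + (2 * c + 2))).
  elim: (T) => [|K IHK]; first by rewrite /qpoch !big_ord0.
  rewrite big_ord_recr mulnS addnC -IHK /= !addnS addn0 !qpochS -!mulrA.
  congr (_ * _); rewrite !big_cons big_nil mulr1 -!exprM !mulrA.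
  by do 7?congr (_ * _); congr (1 - q ^+ _); lia.
rewrite prod_G_parts E8 big_split /= -/(B 3) -/(B 5).
under eq_bigr do rewrite !big_cons big_nil mulr1.
under [RHS]eq_bigr do rewrite !big_cons big_nil mulr1.
rewrite !big_split /= -/(A 2) -/(A 3) -/(A 4) -/(A 5) -/(A 6) -/(A 8) -/(A 10).
rewrite -/(A 11) -/(A 12) -/(A 13) -/(A 14) -/(A 16) -(BAA 2) -(BAA 4) /=.
ring.
Qed.

End Nilpotent.

(** * Counting by bijections and enumerating words *)

Section Counting.

Lemma count_bij (A B : eqType) (f : A -> B) (g : B -> A)
    (P : pred A) (Q : pred B) (s : seq A) (t : seq B) :
    uniq s -> uniq t ->
    (forall x, P x -> [/\ Q (f x), f x \in t & g (f x) = x]) ->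
    (forall y, Q y -> [/\ P (g y), g y \in s & f (g y) = y]) ->
  count P s = count Q t.
Proof.
move=> s_uniq t_uniq PQ QP; rewrite -!size_filter -(size_map f).
apply: perm_size; apply: uniq_perm; rewrite ?filter_uniq //.
  rewrite map_inj_in_uniq ?filter_uniq // => x y.
  rewrite !mem_filter => /andP[/PQ[_ _ gfx] _] /andP[/PQ[_ _ gfy] _] fxy.
  by rewrite -gfx fxy gfy.
move=> y; apply/mapP/idP => [[x] | ].
  by rewrite !mem_filter => /andP[/PQ[Qfx tfx _] _] ->; rewrite Qfx.
rewrite mem_filter => /andP[/QP[Pgy sgy fgy] _].
by exists (g y); rewrite ?mem_filter ?Pgy.
Qed.

Lemma count_split (A : Type) (Q P P1 P2 : pred A) (s : seq A) :
    (forall x, P1 x = P x && Q x) -> (forall x, P2 x = P x && ~~ Q x) ->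
  count P s = count P1 s + count P2 s.
Proof.
move=> P1E P2E; rewrite (eq_count P1E) (eq_count P2E).
by elim: s => //= x s ->; case: (P x); case: (Q x) => /=; lia.
Qed.

Lemma count_fibers (A : Type) (h : A -> nat) (P : pred A) (s : seq A) m :
    (forall x, P x -> h x < m) ->
  count P s = \sum_(k < m) count (fun x => P x && (h x == k)) s.
Proof.
move=> lt_hm; elim: s => [|x s IHs] /=; first by rewrite big1.
rewrite big_split -{}IHs /=; congr (_ + _).
have [Px /=|_] := boolP (P x); last by rewrite big1.
rewrite (bigD1 (Ordinal (lt_hm x Px))) //= eqxx big1 // => k.
by rewrite eq_sym -val_eqE /= => /negPf->.
Qed.

Lemma mem_words (A : eqType) (a : seq A) k w :
  (w \in words a k) = (size w == k) && all (mem a) w.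
Proof.
elim: k w => [|k IHk] [|x w] //=; first by apply/allpairsP => [[[]]] ? ? [].
rewrite eqSS andbCA -IHk; apply/allpairsP/andP => [[[y v] [/= ? ? [-> ->]]] // | [? ?]].
by exists (x, w).
Qed.

Lemma words_uniq (A : eqType) (a : seq A) k : uniq a -> uniq (words a k).
Proof.
move=> a_uniq; elim: k => //= k IHk.
by apply: allpairs_uniq => // -[x v] [y w] _ _ /= [-> ->].
Qed.

Lemma mem_words_upto (A : eqType) (a : seq A) n w :
  (w \in words_upto a n) = (size w <= n) && all (mem a) w.
Proof.
apply/flatten_mapP/andP => [[k] | [le_wn aw]].
  by rewrite mem_iota mem_words => /= le_kn /andP[/eqP-> ->].
by exists (size w); rewrite ?mem_iota ?mem_words ?eqxx.
Qed.

Lemma words_upto_uniq (A : eqType) (a : seq A) n :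
  uniq a -> uniq (words_upto a n).
Proof.
move=> a_uniq; rewrite /words_upto; elim: n.+1 0 => //= {}n IHn m.
rewrite cat_uniq words_uniq // IHn andbT; apply/hasPn => w /flatten_mapP[k].
rewrite mem_iota mem_words => /andP[lt_mk _] /andP[/eqP size_w _].
by rewrite mem_words size_w; apply/nandP; left; rewrite gtn_eqF.
Qed.

Lemma leq_sumn x s : x \in s -> x <= sumn s.
Proof.
elim: s => //= y s IHs; rewrite in_cons => /orP[/eqP->|/IHs]; rewrite ?leq_addr //.
by move=> /leq_trans-> //; rewrite leq_addl.
Qed.

Lemma size_leq_sumn s : all (leq 1) s -> size s <= sumn s.
Proof. by elim: s => //= y s IHs /andP[y_gt0 /IHs]; lia. Qed.

End Counting.

(** * Truncated generating functions *)

Section GeneratingFunctions.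
Local Open Scope ring_scope.
Variables (R : comNzRingType) (q : R) (n : nat).
Hypothesis q_nilp : q ^+ n.+1 = 0.

Definition genfun (c : nat -> nat) : R := \sum_(i < n.+1) q ^+ i *+ c i.

Lemma eq_genfun c c' : (forall i, (i <= n)%N -> c i = c' i) ->
  genfun c = genfun c'.
Proof. by move=> eq_c; apply: eq_bigr => i _; rewrite eq_c // -ltnS. Qed.

(** Turns a counting recurrence with delay [a] into a functional equation; coefficients pushed past
    degree [n] vanish by [q_nilp]. *)
Lemma genfun_shift a c c1 c2 :
    (forall i, i <= n -> c i = c1 i + (if a <= i then c2 (i - a) else 0))%N ->
  genfun c = genfun c1 + q ^+ a * genfun c2.
Proof.
move=> cE; transitivity (\sum_(i < n.+1)
    (q ^+ i *+ c1 i + q ^+ i *+ (if a <= i then c2 (i - a) else 0)%N)).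
  by apply: eq_bigr => i _; rewrite cE ?mulrnDr // -ltnS.
rewrite big_split; congr (_ + _) => {c c1 cE}/=.
elim: a => [|a IHa].
  by rewrite mul1r; apply: eq_bigr => i _; rewrite subn0.
rewrite exprS -mulrA -IHa big_ord_recl mulr0n add0r.
rewrite [X in _ * X]big_ord_recr mulrDr mulrnAr -exprS q_nilp mul0rn addr0.
rewrite mulr_sumr; apply: eq_bigr => i _ /=.
by rewrite /bump leq0n add1n ltnS subSS exprS mulrnAr.
Qed.

End GeneratingFunctions.

(** * Partitions into parts from a given list *)

Section GPartitions.

Definition partition_of (L : seq nat) (i : nat) (s : seq nat) : bool :=
  [&& sorted leq s, all (mem L) s & sumn s == i].

(** The enumerated words depend on [n] but not on [i], so a recurrence in [i] compares counts over
    one fixed list. *)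
Definition npart (n : nat) (L : seq nat) (i : nat) : nat :=
  count (partition_of L i) (words_upto (iota 1 n) n).

Lemma partition_of_words L i n s : all (leq 1) L -> i <= n ->
  partition_of L i s -> s \in words_upto (iota 1 n) n.
Proof.
move=> /allP L_gt0 le_in /and3P[_ /allP sL /eqP sum_s].
have s_gt0 : all (leq 1) s by apply/allP => p /sL/L_gt0.
rewrite mem_words_upto (leq_trans (size_leq_sumn s_gt0)) ?sum_s //=.
apply/allP => p ps; rewrite /= mem_iota (allP s_gt0) // add1n ltnS.
by rewrite (leq_trans (leq_sumn ps)) // sum_s.
Qed.

Lemma npart_nil n i : npart n [::] i = (i == 0).
Proof.
rewrite /npart (eq_count (a2 := fun s => (i == 0) && pred1 [::] s)).
  case: eqP => _; last by rewrite count_pred0.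
  by rewrite count_uniq_mem ?words_upto_uniq ?iota_uniq // mem_words_upto.
by case=> [|x s]; rewrite /partition_of /= ?andbF ?andbT // eq_sym.
Qed.

(** Split on whether [a] occurs: being the least allowed part, it is then the head of the sorted
    list and can be removed. *)
Lemma npart_cons n a L i : 0 < a -> all (ltn a) L -> i <= n ->
  npart n (a :: L) i =
  npart n L i + (if a <= i then npart n (a :: L) (i - a) else 0).
Proof.
move=> a_gt0 aL le_in; have lt_aL p : p \in L -> a < p by move/(allP aL p).
have aL_gt0 : all (leq 1) (a :: L).
  by rewrite /= a_gt0; apply: sub_all aL => p; apply: leq_trans.
have U_uniq := words_upto_uniq n (iota_uniq 1 n).
rewrite [RHS]addnC {1}/npart; set P := partition_of (a :: L) i.
rewrite (count_split (Q := fun s => a \in s) (P := P) (P1 := fun s => P s && (a \in s))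
  (P2 := partition_of L i)) //; last first.
  move=> s; rewrite /P /partition_of -[RHS]andbA; congr (_ && _).
  rewrite [RHS]andbAC; congr (_ && _).
  have aNL : a \notin L by apply/negP => /lt_aL; rewrite ltnn.
  apply/allP/andP => [sL | [/allP sL a's] p ps].
    split; last by apply: contra aNL => /sL.
    by apply/allP => p /sL pL; rewrite /= inE [p \in L]pL orbT.
  have := sL p ps; rewrite /= inE => /predU1P[eq_pa|//].
  by rewrite -eq_pa ps in a's.
congr (_ + _); case: ifP => [le_ai | lt_ia].
  apply: (count_bij (f := behead) (g := cons a)) => // [s | s Ps].
    case/andP=> Ps as_; have /and3P[s_sorted sL /eqP sum_s] := Ps.
    case: s as_ s_sorted sL sum_s {Ps} => // b s as_ /= bs /andP[bL sL] sum_s.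
    have eq_ba : b = a.
      apply/eqP; rewrite eqn_leq; move: bL as_; rewrite /= !inE.
      case/predU1P=> [-> _|/lt_aL/ltnW-> /predU1P[->|]]; rewrite ?leqnn //.
      by move: bs; rewrite (path_sortedE leq_trans) => /andP[/allP bs _] /bs ->.
    have Ps : partition_of (a :: L) (i - a) s.
      rewrite /partition_of sL (path_sorted bs) -sum_s eq_ba addKn eqxx //.
    rewrite Ps (partition_of_words aL_gt0 _ Ps) ?eq_ba //.
    exact: leq_trans (leq_subr _ _) le_in.
  suff Pas : partition_of (a :: L) i (a :: s).
    by rewrite /P Pas mem_head (partition_of_words aL_gt0 _ Pas).
  have /and3P[s_sorted sL /eqP sum_s] := Ps.
  rewrite /partition_of /= sL inE eqxx sum_s subnKC // eqxx !andbT.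
  rewrite (path_sortedE leq_trans) s_sorted andbT; apply/allP => p /(allP sL) /=.
  by rewrite inE => /predU1P[-> // | /lt_aL/ltnW].
rewrite (eq_count (a2 := pred0)) ?count_pred0 // => s; apply/negP.
case/andP=> /and3P[_ _ /eqP sum_s] /leq_sumn.
by rewrite sum_s lt_ia.
Qed.

Lemma G_npart n m i : i <= n -> n < m ->
  G i = npart n [seq p <- iota 0 m | G_part p] i.
Proof.
move=> le_in lt_nm; have U_uniq k := words_upto_uniq k (iota_uniq 1 k).
set L := filter _ _.
have L_gt0 : all (leq 1) L by apply/allP => -[|p] //; rewrite mem_filter.
have PE s : is_G_partition i s = partition_of L i s.
  apply/and4P/and3P => [[-> /allP gt0 sum_s /allP Gs] | [-> /allP sL sum_s]].
    split=> //; apply/allP => p ps; rewrite /= mem_filter Gs // mem_iota /=.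
    apply: leq_ltn_trans (leq_sumn ps) _.
    by rewrite (eqP sum_s) (leq_ltn_trans le_in).
  split=> //; apply/allP => p /sL pL; first exact: (allP L_gt0).
  by move: pL; rewrite /= mem_filter => /andP[].
rewrite /G (eq_count PE) /npart.
by apply: (count_bij (f := id) (g := id)) => // s Ps;
  rewrite Ps (partition_of_words L_gt0 _ Ps).
Qed.

Lemma genfun_npart (R : comNzRingType) (q : R) n (L : seq nat) :
    (q ^+ n.+1 = 0)%R -> sorted ltn L -> all (ltn 0) L ->
  (genfun q n (npart n L) * \prod_(p <- L) (1 - q ^+ p) = 1)%R.
Proof.
move=> q_nilp; elim: L => [_ _|a L IHL L_sorted /= /andP[a_gt0 L_gt0]].
  rewrite big_nil mulr1 (eq_genfun _ (fun i _ => npart_nil n i)) /genfun.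
  by rewrite big_ord_recl big1 /= ?addr0.
move: L_sorted; rewrite /= (path_sortedE ltn_trans) => /andP[aL L_sorted].
have E := genfun_shift q_nilp (fun i => npart_cons (i := i) a_gt0 aL).
rewrite big_cons mulrA -[RHS](IHL L_sorted L_gt0); congr (_ * _)%R.
by rewrite mulrBr mulr1 {1}E [X in (_ - X)%R]mulrC addrK.
Qed.

Lemma genfun_G (R : comNzRingType) (q : R) n m :
    (q ^+ n.+1 = 0)%R -> n < m ->
  (genfun q n G * \prod_(p <- iota 0 m | G_part p) (1 - q ^+ p) = 1)%R.
Proof.
move=> q_nilp lt_nm.
rewrite (eq_genfun _ (fun i le_in => G_npart le_in lt_nm)) -big_filter.
apply: genfun_npart => //.
  exact/(sorted_filter ltn_trans)/iota_ltn_sorted.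
by apply/allP => -[|p] //; rewrite mem_filter.
Qed.

End GPartitions.

(** * Recurrences for partitions with n copies of n *)

Section HPartitions.

Notation part := (nat * nat)%type.

Definition even_pos (p : part) : bool := (0 < p.2) && ~~ odd p.2.

Definition part_lt (a b : part) : bool :=
  (a.1 + a.2 + b.2 <= b.1) &&
  ~~ [&& odd a.1, odd b.1 & b.1 == a.1 + a.2 + b.2].

Lemma H_adjE : H_adj =2 part_lt.
Proof. by move=> [m i] [k j]; rewrite /H_adj /part_lt /wdiff /=; lia. Qed.

Definition Hchain (a : part) (s : seq part) : bool :=
  all even_pos s && path part_lt a s.

Definition weight (s : seq part) : nat := sumn (map fst s).

Lemma Hchain_cons a b s :
  Hchain a (b :: s) = [&& even_pos b, part_lt a b & Hchain b s].
Proof. by rewrite /Hchain /= -andbA [all _ _ && _]andbCA. Qed.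

(** Values only grow along a chain, so the bound for the first part passes to all. It keeps the
    truncated subtraction in [unshift] exact. *)
Lemma Hchain_bound a s (p : part) :
  Hchain a s -> p \in s -> a.1 + a.2 + p.2 <= p.1 /\ 1 < p.2.
Proof.
elim: s a => // b s IHs a; rewrite Hchain_cons => /and3P[b_ev ab bs].
rewrite inE => /predU1P[-> | /(IHs _ bs)];
  by move: b_ev ab; rewrite /even_pos /part_lt; lia.
Qed.

(* The virtual part [(0, 0)] in front encodes the condition [j <= m] on the
   first part [m_j]; on later parts it follows from the difference condition. *)
Lemma is_H_partitionE n s :
  is_H_partition n s = Hchain (0, 0) s && (weight s == n).
Proof.
rewrite /is_H_partition /Hchain /weight.
rewrite (eq_sorted H_adjE).
apply/and5P/andP => [[_ s_copy -> s_even s_lt] | [/andP[s_ev s_lt] ->]].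
  split=> //; apply/andP; split.
    apply/allP => p ps; move: (allP s_copy p ps) (allP s_even p ps).
    by rewrite /even_pos /is_copy_part => /andP[-> _] ->.
  case: s s_copy s_lt {s_even} => //= a s /andP[a_copy _] ->.
  by move: a_copy; rewrite /part_lt /is_copy_part /=; lia.
have sH : Hchain (0, 0) s by rewrite /Hchain s_ev.
split=> //.
- apply: sub_sorted (path_sorted s_lt) => a b.
  by rewrite /part_lt /lex_le; lia.
- by apply/allP => p /(Hchain_bound sH); rewrite /is_copy_part; lia.
- by apply: sub_all s_ev => p /andP[].
exact: path_sorted s_lt.
Qed.

Definition shift_part c (p : part) : part := (p.1 + c, p.2).
Definition shift c := map (shift_part c).
Definition unshift c := map (fun p : part => (p.1 - c, p.2)).

Lemma shiftK c : cancel (shift c) (unshift c).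
Proof. by apply: mapK => -[m j]; rewrite /shift_part /= addnK. Qed.

Lemma size_shift c s : size (shift c s) = size s.
Proof. exact: size_map. Qed.

Lemma weight_shift c s : weight (shift c s) = weight s + c * size s.
Proof.
by elim: s => [|p s]; rewrite ?muln0 // /weight /= => ->; lia.
Qed.

Lemma unshiftK a c s : Hchain a s -> c <= a.1 + a.2 + 2 -> exists t, s = shift c t.
Proof.
move=> as_chain le_c; exists (unshift c s).
rewrite /shift /unshift -map_comp map_id_in // => -[m j] mj.
have /= := Hchain_bound as_chain mj.
by move=> [? ?]; rewrite /shift_part /= subnK //; lia.
Qed.

(** An even shift preserves parities and differences inside the list; only the link to the
    predecessor has to be checked. *)
Lemma Hchain_shift a b c s : ~~ odd c ->
    (forall p, even_pos p -> part_lt b (shift_part c p) = part_lt a p) ->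
  Hchain b (shift c s) = Hchain a s.
Proof.
move=> c_even; elim: s a b => // p s IHs a b ab.
rewrite /= !Hchain_cons /= -[even_pos (shift_part c p)]/(even_pos p).
case p_ev: (even_pos p) => //=.
rewrite ab // (IHs p) // => r _.
by rewrite /part_lt /=; lia.
Qed.

Definition Hpart k i s := [&& Hchain (0, 0) s, size s == k & weight s == i].
(* Subtracting 2 from every part would violate [j <= m] at the first part. *)
Definition tight k i s :=
  Hpart k i s && ((head (0, 0) s).1 <= (head (0, 0) s).2 + 1).

Definition Hwords n :=
  words_upto [seq (m, i) | m <- iota 1 n, i <- iota 1 n] n.

Lemma Hpart_cons k i a s : Hpart k.+1 i (a :: s) =
  [&& even_pos a, a.2 <= a.1, Hchain a s, size s == k & a.1 + weight s == i].
Proof. by rewrite /Hpart Hchain_cons -!andbA. Qed.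

Lemma Hwords_uniq n : uniq (Hwords n).
Proof.
apply/words_upto_uniq/allpairs_uniq; rewrite ?iota_uniq //.
by move=> [a b] [c d].
Qed.

Lemma Hpart_words n k i s : i <= n -> Hpart k i s -> s \in Hwords n.
Proof.
move=> le_in /and3P[sH _ /eqP wt_s].
have s_gt0 : all (leq 1) (map fst s).
  by apply/allP => m /mapP[p /(Hchain_bound sH) /= p_bd ->]; lia.
rewrite mem_words_upto -(size_map fst) (leq_trans (size_leq_sumn s_gt0)) /=;
  last by rewrite -/(weight s) wt_s.
apply/allP => -[m j] mj; have /= mj_bd := Hchain_bound sH mj.
have := leq_sumn (map_f fst mj); rewrite -/(weight s) wt_s /= => le_mi.
by apply/allpairsP; exists (m, j); rewrite /= !mem_iota; split=> //; lia.
Qed.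

Lemma count_Hwords n d i (P : pred (seq part)) (Q : nat -> pred (seq part)) f g :
    (forall s, P s -> s \in Hwords n) ->
    (forall j s, j <= n -> Q j s -> s \in Hwords n) -> i <= n ->
    (forall s, P s -> [/\ d <= i, Q (i - d) (f s) & g (f s) = s]) ->
    (forall j s, j + d = i -> Q j s -> P (g s) /\ f (g s) = s) ->
  count P (Hwords n) = if d <= i then count (Q (i - d)) (Hwords n) else 0.
Proof.
move=> PU QU le_in PQ QP; case: ifP => [le_di | lt_id].
  apply: (count_bij (f := f) (g := g)); rewrite ?Hwords_uniq // => s.
    move=> /PQ[_ Qfs ->]; split=> //; apply: QU Qfs.
    exact: leq_trans (leq_subr _ _) le_in.
  by move=> /(QP _ _ (subnK le_di))[Pgs fgs]; split=> //; apply: PU.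
apply/eqP; rewrite -leqn0 leqNgt -has_count; apply/hasPn => s _.
by apply/negP => /PQ[]; rewrite lt_id.
Qed.

Definition Hcount n k i := count (Hpart k i) (Hwords n).
Definition Tcount n k i := count (tight k i) (Hwords n).

Lemma tight_words n k i s : i <= n -> tight k i s -> s \in Hwords n.
Proof. by move=> le_in /andP[/(Hpart_words le_in)]. Qed.

(** When the list is not [tight], its first part has m >= j + 2, so 2 can be subtracted from each of
    the k + 1 parts. *)
Lemma Hcount_rec n k i : i <= n ->
  Hcount n k.+1 i = Tcount n k.+1 i +
    (if 2 * k + 2 <= i then Hcount n k.+1 (i - (2 * k + 2)) else 0).
Proof.
move=> le_in; rewrite /Hcount (count_split (P1 := tight k.+1 i)
  (P2 := fun s => Hpart k.+1 i s && ~~ ((head (0, 0) s).1 <= (head (0, 0) s).2 + 1))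
  (Q := fun s => (head (0, 0) s).1 <= (head (0, 0) s).2 + 1)) //.
congr (_ + _); apply: (count_Hwords (Q := Hpart k.+1) (f := unshift 2) (g := shift 2)) => //.
- by move=> s /andP[/(Hpart_words le_in)].
- by move=> j s; apply: Hpart_words.
- move=> [|[m j] s]; first by case/andP=> /and3P[].
  rewrite Hpart_cons /= => /andP[/and5P[j_ev le_jm ch /eqP sz /eqP wt] lt_m].
  have [|t def_s] := unshiftK (c := 2) ch; first by rewrite leq_addl.
  move: ch wt sz; rewrite def_s shiftK weight_shift size_shift => ch wt sz.
  have def_m : m = (m - 2) + 2 by lia.
  split; first by lia.
    rewrite Hpart_cons sz eqxx /= -(@Hchain_shift (m - 2, j) (m, j) 2) ?ch //; last first.
      by move=> p _; rewrite /part_lt /=; lia.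
    by move: j_ev; rewrite /even_pos /=; lia.
  by rewrite /shift_part /= -def_m.
move=> l [|[m j] s] def_i; first by case/and3P.
rewrite Hpart_cons shiftK => /and5P[j_ev le_jm ch /eqP sz /eqP wt].
split=> //=; rewrite Hpart_cons /= size_shift weight_shift sz eqxx.
rewrite (@Hchain_shift (m, j)) ?ch //; last by move=> p _; rewrite /part_lt /=; lia.
by move: j_ev le_jm wt; rewrite /even_pos /=; lia.
Qed.

(** A tight first part has m = j or m = j + 1. The cases are 2_2, 3_2, and j >= 4, where lowering
    both m and j by 2 lowers m + j by 4 and lets the other k parts drop by 4. *)
Lemma Tcount_rec n k i : i <= n ->
  Tcount n k.+1 i =
    (if 4 * k + 2 <= i then Hcount n k (i - (4 * k + 2)) else 0) +
    (if 6 * k + 3 <= i then Hcount n k (i - (6 * k + 3)) else 0) +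
    (if 4 * k + 2 <= i then Tcount n k.+1 (i - (4 * k + 2)) else 0).
Proof.
move=> le_in; pose hd := head (0, 0) : seq part -> part.
rewrite /Tcount (count_split (P1 := fun s => tight k.+1 i s && ((hd s).2 == 2))
  (P2 := fun s => tight k.+1 i s && ((hd s).2 != 2))
  (Q := fun s => (hd s).2 == 2)) //.
rewrite (count_split (P1 := fun s => Hpart k.+1 i s && (hd s == (2, 2)))
  (P2 := fun s => Hpart k.+1 i s && (hd s == (3, 2)))
  (P := fun s => tight k.+1 i s && ((hd s).2 == 2))
  (Q := fun s => (hd s).1 == 2)); first last.
- case=> [|[m j] s]; first by rewrite /tight /Hpart.
  rewrite /tight Hpart_cons /hd /= -pair_eqE /= /even_pos /=; lia.
- case=> [|[m j] s]; first by rewrite /tight /Hpart.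
  rewrite /tight Hpart_cons /hd /= -pair_eqE /= /even_pos /=; lia.
congr (_ + _ + _).
- apply: (count_Hwords (Q := Hpart k) (f := unshift 4 \o behead)
    (g := fun s => (2, 2) :: shift 4 s)) => //.
  + by move=> s /andP[/(Hpart_words le_in)].
  + by move=> j s; apply: Hpart_words.
  + move=> [|a s]; first by case/andP=> /and3P[].
    rewrite /hd /= => /andP[s_part /eqP def_a].
    move: s_part; rewrite {a}def_a Hpart_cons => /and5P[_ _ ch /eqP sz /eqP wt].
    have [|t def_s] := unshiftK (c := 4) ch; first by [].
    move: ch wt sz; rewrite def_s shiftK weight_shift size_shift /= => ch wt sz.
    split=> //; first by lia.
    rewrite /Hpart sz eqxx -(@Hchain_shift (0, 0) (2, 2) 4) ?ch //; last first.
      by move=> p _; rewrite /part_lt /=; lia.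
    by rewrite /=; lia.
  + move=> l s def_i /and3P[ch /eqP sz /eqP wt]; rewrite /= shiftK /hd eqxx andbT.
    split=> //; rewrite Hpart_cons /= size_shift weight_shift sz eqxx.
    rewrite (@Hchain_shift (0, 0)) ?ch //; first by lia.
    by move=> p _; rewrite /part_lt /=; lia.
(* The shift is 6, not 3 + 2 = 5: equality in the difference condition would make the next value 5
   plus an even subscript, hence odd, and two odd values at weighted difference 0 are forbidden. *)
- apply: (count_Hwords (Q := Hpart k) (f := unshift 6 \o behead)
    (g := fun s => (3, 2) :: shift 6 s)) => //.
  + by move=> s /andP[/(Hpart_words le_in)].
  + by move=> j s; apply: Hpart_words.
  + move=> [|a s]; first by case/andP=> /and3P[].
    rewrite /hd /= => /andP[s_part /eqP def_a].
    move: s_part; rewrite {a}def_a Hpart_cons => /and5P[_ _ ch /eqP sz /eqP wt].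
    have [|t def_s] := unshiftK (c := 6) ch; first by [].
    move: ch wt sz; rewrite def_s shiftK weight_shift size_shift /= => ch wt sz.
    split=> //; first by lia.
    rewrite /Hpart sz eqxx -(@Hchain_shift (0, 0) (3, 2) 6) ?ch //; last first.
      by move=> p; rewrite /even_pos /part_lt /=; lia.
    by rewrite /=; lia.
  + move=> l s def_i /and3P[ch /eqP sz /eqP wt]; rewrite /= shiftK /hd eqxx andbT.
    split=> //; rewrite Hpart_cons /= size_shift weight_shift sz eqxx.
    rewrite (@Hchain_shift (0, 0)) ?ch //; first by lia.
    by move=> p; rewrite /even_pos /part_lt /=; lia.
apply: (count_Hwords (Q := tight k.+1)
  (f := fun s => ((hd s).1 - 2, (hd s).2 - 2) :: unshift 4 (behead s))
  (g := fun s => ((hd s).1 + 2, (hd s).2 + 2) :: shift 4 (behead s))) => //.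
- by move=> s /andP[/(tight_words le_in)].
- by move=> j s; apply: tight_words.
- move=> [|[m j] s]; first by case/andP=> /andP[/and3P[]].
  rewrite /tight Hpart_cons /hd /=.
  move=> /andP[/andP[/and5P[j_ev le_jm ch /eqP sz /eqP wt] le_m] ne_j2].
  move: j_ev le_jm le_m wt; rewrite /even_pos /= => j_ev le_jm le_m wt.
  have [|t def_s] := unshiftK (c := 4) ch; first by rewrite /=; lia.
  move: ch wt sz; rewrite def_s shiftK weight_shift size_shift => ch wt sz.
  split; [by lia | | by congr ((_, _) :: _); lia].
  rewrite Hpart_cons sz eqxx -(@Hchain_shift (m - 2, j - 2) (m, j) 4) ?ch //.
    by rewrite /even_pos /=; lia.
  by move=> p _; rewrite /part_lt /=; lia.
move=> l [|[m j] s] def_i; first by case/andP=> /and3P[].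
rewrite /tight Hpart_cons /hd /= shiftK !addnK.
move=> /andP[/and5P[j_ev le_jm ch /eqP sz /eqP wt] le_m].
split=> //; rewrite Hpart_cons /= size_shift weight_shift sz eqxx.
rewrite (@Hchain_shift (m, j)) ?ch //; last by move=> p _; rewrite /part_lt /=; lia.
by move: j_ev le_jm wt le_m; rewrite /even_pos /=; lia.
Qed.

Lemma Hcount0 n i : Hcount n 0 i = (i == 0).
Proof.
rewrite /Hcount (eq_count (a2 := fun s => (i == 0) && pred1 [::] s)).
  case: eqP => _; last by rewrite count_pred0.
  by rewrite count_uniq_mem ?Hwords_uniq // mem_words_upto.
by case=> [|x s]; rewrite /Hpart /= ?andbF ?andbT // eq_sym.
Qed.

Lemma H_Hcount n m i : i <= n -> n < m -> H i = \sum_(k < m) Hcount n k i.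
Proof.
move=> le_in lt_nm; rewrite /H -/(Hwords i) (eq_count (is_H_partitionE i)).
pose P s := Hchain (0, 0) s && (weight s == i).
have PE s : P s = Hpart (size s) i s by rewrite /Hpart eqxx.
transitivity (count P (Hwords n)).
  apply: (count_bij (f := id) (g := id)); rewrite ?Hwords_uniq // => s.
    rewrite -/(P s) => Ps; split=> //; apply: (Hpart_words (k := size s) le_in).
    by rewrite -PE.
  by move=> Ps; split=> //; apply: (Hpart_words (k := size s) (leqnn i)); rewrite -PE.
rewrite (@count_fibers _ size _ _ m) => [|s].
  apply: eq_bigr => k _; apply: eq_count => s.
  by rewrite /P /Hpart andbAC -andbA.
rewrite PE => /(Hpart_words le_in); rewrite mem_words_upto => /andP[le_sn _].
exact: leq_ltn_trans lt_nm.
Qed.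

End HPartitions.

(** * Assembling the identity and extracting coefficients *)

Section Identity.
Local Open Scope ring_scope.
Variable R : comNzRingType.
Implicit Types (q r : R).

Lemma genfun_Hcount q n k : q ^+ n.+1 = 0 ->
  genfun q n (Hcount n k) * qpoch q (2 * k) = q ^+ (2 * k ^ 2).
Proof.
move=> q_nilp; have genfun0 : genfun q n (fun=> 0%N) = 0.
  by rewrite /genfun big1.
elim: k => [|k IHk].
  rewrite muln0 /qpoch big_ord0 mulr1 (eq_genfun _ (fun i _ => Hcount0 n i)).
  by rewrite /genfun big_ord_recl big1 ?addr0.
set h' := genfun q n (Hcount n k) in IHk; set h := genfun _ _ _.
pose t := genfun q n (Tcount n k.+1).
pose shifted a i := (if a <= i then Hcount n k (i - a) else 0)%N.
have hE : h = t + q ^+ (2 * k + 2) * h.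
  exact: (genfun_shift q_nilp (fun i => @Hcount_rec n k i)).
have E1 : genfun q n (shifted (4 * k + 2)%N) = 0 + q ^+ (4 * k + 2) * h'.
  by rewrite -genfun0; apply: genfun_shift.
have E2 : genfun q n (fun i => shifted (4 * k + 2) i + shifted (6 * k + 3) i)%N =
    genfun q n (shifted (4 * k + 2)%N) + q ^+ (6 * k + 3) * h'.
  by apply: genfun_shift.
have : t = genfun q n (fun i => shifted (4 * k + 2) i + shifted (6 * k + 3) i)%N +
    q ^+ (4 * k + 2) * t.
  exact: (genfun_shift q_nilp (fun i => @Tcount_rec n k i)).
rewrite E2 E1 add0r => tE {E1 E2}.
have {hE tE} h_rec : h * (1 - q ^+ (2 * k + 2)) * (1 - q ^+ (4 * k + 2)) =
    q ^+ (4 * k + 2) * (1 + q ^+ (2 * k + 1)) * h'.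
  have -> : h * (1 - q ^+ (2 * k + 2)) = t by rewrite mulrBr {1}hE; ring.
  rewrite mulrBr mulr1 {1}tE.
  by rewrite (_ : 6 * k + 3 = (4 * k + 2) + (2 * k + 1))%N ?exprD; [ring | lia].
(* Since 1 - q^(4k+2) = (1 - q^(2k+1)) (1 + q^(2k+1)), the factor 1 + q^(2k+1) appears on both
   sides; cancelling it leaves the two new factors of [qpoch q (2 * k.+1)]. *)
apply: (one_add_expr_inj (k := 2 * k) q_nilp).
transitivity (h * (1 - q ^+ (2 * k + 2)) * (1 - q ^+ (4 * k + 2)) * qpoch q (2 * k)).
  rewrite mulnS !addSn add0n !qpochS addnS addn1.
  by rewrite (_ : 4 * k + 2 = (2 * k).+1 * 2)%N ?exprM; [ring | lia].
rewrite h_rec -mulrA IHk mulrAC -exprD addn1.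
by congr (q ^+ _ * _); lia.
Qed.

Lemma genfun_H q n m : q ^+ n.+1 = 0 -> (n < m)%N ->
  genfun q n H = \sum_(k < m) genfun q n (Hcount n k).
Proof.
move=> q_nilp lt_nm; rewrite (eq_genfun _ (fun i le_in => H_Hcount le_in lt_nm)).
rewrite /genfun exchange_big; apply: eq_bigr => i _ /=.
by rewrite -sumrMnr.
Qed.

Lemma genfun_H_qbin q n M : q ^+ n.+1 = 0 -> (n <= M)%N ->
  genfun q n H =
  \sum_(k < (2 * M).+1) q ^+ (2 * k ^ 2) * qbin q (4 * M) (2 * k).
Proof.
move=> q_nilp le_nM; rewrite (@genfun_H _ _ (2 * M).+1) //; last by lia.
apply: eq_bigr => -[k /= le_k] _; apply: (qpoch_inj (k := 2 * k) q_nilp).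
rewrite genfun_Hcount // -mulrA (_ : 4 * M = 2 * k + (4 * M - 2 * k))%N; last by lia.
rewrite (qbin_limit _ q_nilp) // -exprD.
(* For [k] near 2M the remainder 4M - 2k is short, but then 2k^2 alone is large enough. *)
have /subnKC <- : (n < 2 * k ^ 2 + (4 * M - 2 * k).+1)%N by nia.
by rewrite exprD q_nilp mul0r.
Qed.

Lemma genfun_G_H r n : (forall x y : R, x + x = y + y -> x = y) ->
  (r ^+ 2) ^+ n.+1 = 0 -> genfun (r ^+ 2) n G = genfun (r ^+ 2) n H.
Proof.
(* With T = n + 1, this choice makes M = 2T and 4M = 8T, the lengths in [prod_Slater39]. *)
move=> two_inj q_nilp; set q := r ^+ 2 in q_nilp *; pose M := (2 * n.+1)%N.
have lt_nM : (n < M)%N by rewrite /M; lia.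
have lt_n : (n < 16 * n.+1)%N by lia.
have GW := genfun_G q_nilp lt_n.
rewrite (genfun_H_qbin q_nilp (ltnW lt_nM)) (even_part_identity r M two_inj) -/q.
set S := \sum_(k < _) _; set W := \prod_(p <- _ | _) _ in GW.
suff SW : S * W = 1 by rewrite -[LHS]mulr1 -SW mulrCA GW mulr1.
apply: (qpoch_inj (Q := q ^+ 2) (T := n.+1) (k := 4 * M)).
  by rewrite exprAC q_nilp expr0n.
rewrite mul1r mulrAC (theta_limit q_nilp lt_nM) prod_Slater39 //.
by congr qpoch; rewrite /M; lia.
Qed.

(* The two-variable identities live over a square root [r] of [q], so the
   truncation order in [r] is doubled. *)
Lemma qpoly_genfun_inj n (c c' : nat -> nat) :
  let r := qpolyX ('X^(2 * n.+1) : {poly int}) in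
  genfun (r ^+ 2) n c = genfun (r ^+ 2) n c' -> c n = c' n.
Proof.
move=> r; pose p (d : nat -> nat) : {poly int} := \sum_(i < n.+1) 'X^(2 * i) *+ d i.
have pE d : genfun (r ^+ 2) n d = in_qpoly 'X^(2 * n.+1) (p d).
  rewrite /p /genfun rmorph_sum; apply: eq_bigr => i _ /=.
  by rewrite rmorphMn rmorphXn -exprM.
(* The degree is at most 2n, so reduction modulo X^(2n+2) leaves [p d] intact and its coefficient at
   2n can be read off. *)
have size_p d : (size (p d) < size (mk_monic ('X^(2 * n.+1) : {poly int})))%N.
  rewrite mk_monic_Xn size_polyXn ltnS; apply: leq_trans (size_sum _ _ _) _.
  apply/bigmax_leqP => i _; rewrite -scaler_nat; apply: leq_trans (size_scale_leq _ _) _.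
  by rewrite size_polyXn; have := ltn_ord i; lia.
have coef_p d : (p d)`_(2 * n) = (d n)%:R.
  rewrite coef_sum big_ord_recr /= coefMn coefXn eqxx big1 ?add0r // => i _.
  by rewrite coefMn coefXn eqn_mul2l /= gtn_eqF ?mul0rn.
rewrite !pE => /(congr1 (@polyn _ _)); rewrite !in_qpoly_small //.
move/(congr1 (fun s : {poly int} => s`_(2 * n))); rewrite !coef_p => /eqP.
by rewrite eqr_nat => /eqP.
Qed.

(** Supplies the cancellation of 2 needed to isolate even parts: reduced representatives have
    integer coefficients, which are free of 2-torsion. *)
Lemma qpoly_double_inj (h : {poly int}) (x y : {poly %/ h}) :
  x + x = y + y -> x = y.
Proof.
move=> xy; apply: val_inj; apply/polyP => i.
have /(congr1 (fun s : {poly int} => s`_i)) : \val (x + x) = \val (y + y).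
  by rewrite xy.
by rewrite /= !coefD -!mulr2n => /eqP; rewrite eqr_pMn2r // => /eqP.
Qed.

Lemma qpolyX_nilpotent (S : comNzRingType) n :
  (qpolyX ('X^(2 * n.+1) : {poly S}) ^+ 2) ^+ n.+1 = 0.
Proof.
rewrite -exprM -rmorphXn; apply: val_inj.
by rewrite /= mk_monic_Xn Pdiv.RingMonic.rmodpp ?monicXn.
Qed.

End Identity.

Theorem theorem31 (n : nat) : 1 <= n -> G n = H n.
Proof.
move=> _; apply: qpoly_genfun_inj; apply: genfun_G_H (qpolyX_nilpotent _ _).
exact: qpoly_double_inj.
Qed.
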